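(* Let $f(x) = \sum_{n=0}^{\infty} a_n x^n$, where $(a_n)_{n\ge 0}$ is a $C^2$-finite sequence of order $r$ and degree $k$, satisfying $$C_{r,n}a_{n+r} + C_{r-1,n}a_{n+r-1}+ \dots + C_{0,n}a_{n} = 0 \qquad (n \ge 0).$$ Then $f(x)$ satisfies a homogeneous linear differential equation with polynomial coefficients $$\sum_{\alpha} \left[ q_{\alpha,0}(x)f(\alpha x)+ q_{\alpha,1}(x)f'(\alpha x) + \dots + q_{\alpha,r'}(x)f^{(r')}(\alpha x)\right] = 0,$$ where $\alpha$ ranges over the roots of the characteristic polynomials of the $C$-finite coefficient sequences $C_{i,n}$, $0\le i\le r$, the order $r'$ is at most $r+k$, and the degree of $q_{\alpha,t}(x)$ is at most $r+k$ for each $\alpha$ and $t$.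
   Context: Sequences are indexed by $n=0,1,2,\dots$ and have complex values; generating functions are formal power series. A sequence $(C_n)_{n\ge0}$ is $C$-finite if it satisfies a homogeneous linear recurrence with constant coefficients $C_{n+d} + c_{d-1}C_{n+d-1}+\dots+c_0 C_n=0$ for all $n\ge 0$; its characteristic polynomial is $N^d+c_{d-1}N^{d-1}+\dots+c_0$. A closed-form formula for such a sequence is $C_n=\sum_{\alpha\in S}p_\alpha(n)\alpha^n$, where $S$ is the set of roots of the characteristic polynomial and the $p_\alpha$ are polynomials. $Deg(C_n)$ denotes the highest degree of the $p_\alpha(n)$, $\alpha\in S$. A sequence $(a_n)_{n\ge 0}$ is $C^2$-finite if it is defined by a linear recurrence with $C$-finite sequence coefficients $$C_{r,n}a_{n+r} + C_{r-1,n}a_{n+r-1}+ \dots + C_{0,n}a_{n} = 0,$$ where each $(C_{i,n})_{n\ge0}$ is $C$-finite and $C_{r,n}\neq 0$ for all $n=0,1,2,\dots$, along with initial values $a_0,\dots,a_{r-1}$. It is said to have order $r$ and degree $k$ if it satisfies such a recurrence in which $Deg(C_{i,n})\le k$ for each $0\le i\le r$. Notation: $f^{(j)}(\alpha x)$ means $\dfrac{d^j f(\alpha x)}{dx^j}$, i.e. the $j$-th derivative with respect to $x$ of the composite $x\mapsto f(\alpha x)$ (and $f'(\alpha x)$ is the case $j=1$). *)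

(* Defs.v *)
From HB Require Import structures.
From mathcomp Require Import all_boot all_order all_algebra.
From mathcomp Require Import boolp classical_sets functions cardinality fsbigop reals.
From mathcomp Require Import complex.
Set Implicit Arguments.
Unset Strict Implicit.
Unset Printing Implicit Defensive.
Import Order.TTheory GRing.Theory Num.Theory.
Local Open Scope classical_set_scope.
Local Open Scope ring_scope.

Section Sequences.
Variable K : fieldType.
Implicit Types (c : nat -> K) (chi : {poly K}).

Definition roots_of chi : set K := [set alpha | root chi alpha].

(* c is C-finite: it satisfies the recurrence whose characteristic polynomial is chi; chi is
   monic, so d = (size chi).-1 and the coefficient of c (n + d) is 1. *)
Definition has_char_poly c chi : Prop :=
  chi \is monic /\
  forall n : nat, \sum_(j < size chi) chi`_j * c (n + j)%N = 0.

(* The index set is finite whenever chi != 0, so that the finitely supported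
   sum is the genuine one.  At alpha = 0 the convention 0 ^+ 0 = 1 applies. *)
Definition closed_form c chi (p : K -> {poly K}) : Prop :=
  forall n : nat,
    c n = \sum_(alpha \in roots_of chi) (p alpha).[n%:R] * alpha ^+ n.

(* Deg c <= k.  The closed form determines p alpha for every root alpha != 0;
   p 0 matters only through its value at 0 and is chosen freely. *)
Definition Deg_le c chi (k : nat) : Prop :=
  exists2 p : K -> {poly K}, closed_form c chi p &
    forall alpha, roots_of chi alpha -> (size (p alpha) <= k.+1)%N.

(* The recurrence exhibiting a as C^2-finite of order r and degree k, with
   coefficient sequences c i and their characteristic polynomials chi i. *)
Definition C2_recurrence (r k : nat) (c : 'I_r.+1 -> nat -> K)
    (chi : 'I_r.+1 -> {poly K}) (a : nat -> K) : Prop :=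
  [/\ forall i, has_char_poly (c i) (chi i),
      forall i, Deg_le (c i) (chi i) k,
      forall n : nat, c ord_max n != 0 &
      forall n : nat, \sum_(i < r.+1) c i n * a (n + i)%N = 0].

Definition all_char_roots (r : nat) (chi : 'I_r.+1 -> {poly K}) : set K :=
  [set alpha | exists i, roots_of (chi i) alpha].

End Sequences.

Section FormalPowerSeries.
Variable K : fieldType.

(* A formal power series is the sequence of its coefficients. *)
Definition fps := nat -> K.
Implicit Types f : fps.

(* f (alpha x), with the constant series f`_0 when alpha = 0. *)
Definition fps_dilate (alpha : K) f : fps := fun n => alpha ^+ n * f n.

Definition fps_deriv f : fps := fun n => n.+1%:R * f n.+1.

Definition fps_derivn (t : nat) f : fps := iter t fps_deriv f.

Definition fps_mul_poly (q : {poly K}) f : fps :=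
  fun n => \sum_(i < n.+1) q`_i * f (n - i)%N.

End FormalPowerSeries.

(* Main.v *)
Require Import Defs.
From HB Require Import structures.
From mathcomp Require Import all_boot all_order all_algebra.
From mathcomp Require Import boolp classical_sets functions cardinality fsbigop reals.
From mathcomp Require Import complex.
Set Implicit Arguments.
Unset Strict Implicit.
Unset Printing Implicit Defensive.
Import Order.TTheory GRing.Theory Num.Theory.
Local Open Scope classical_set_scope.
Local Open Scope ring_scope.

(** Multiply the recurrence at [n] by [(n + r) ^_ r].  This is what turns it into
    the coefficient of [x ^ n] in a differential equation: a term
    [p(n) alpha ^ n a_(n+i)] is, up to the constant [alpha ^- i], the polynomial
    [p(n)] times [g_(n+i)], where [g] is the series [f(alpha x)], while the
    coefficient of [x ^ n] in [x ^ s D ^ (s + i) g] is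
    [(n + i) ^_ (s + i) g_(n+i) = (n + i) ^_ i * n ^_ s * g_(n+i)].  Operators
    lowering the degree by [i] therefore reach exactly the multipliers that are
    divisible by [(n + i) ^_ i], and [(n + r) ^_ r] is divisible by all of these
    for [i <= r] ([horner_rising_poly]).  The cofactor
    [(n + i + 1) ... (n + r) p(n)] has degree at most [r - i + k], so expanding
    it in the falling factorials [n ^_ s] ([falling_poly_expansion]) uses
    [s <= r - i + k]: the derivatives have order [s + i <= r + k] and their
    coefficients degree [s <= r + k].  [dilated_operator] carries this out for
    one [alpha], and summing over the nonzero roots gives the equation.

    The equation is not trivial: since [C_(r,n)] never vanishes, some
    [p_(r,alpha)] is nonzero, and in the coefficient [q_(alpha,t)] the power
    [x ^ s] comes only from the shift [i = t - s], so nothing can cancel.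
    Its order is then read off from the last nonzero coefficient
    ([drop_zero_top]).

    When 0 is one of the roots, some closed form has the extra summand
    [p(n) 0 ^ n], concentrated at [n = 0], and division by [alpha ^ i] is
    impossible.  But then [f(0 x)] is itself one of the series, and it is
    constant: its derivative of order [r + k] vanishes, which is already an
    equation of the required shape.  (If [r + k = 0], the recurrence
    reads [C_(0,n) a_n = 0], so [f = 0].) *)

(** * Falling factorials *)

Lemma ffact_addl (n i s : nat) :
  ((n + i) ^_ (i + s) = (n + i) ^_ i * n ^_ s)%N.
Proof.
elim: i => [|i IHi]; first by rewrite addn0 ffactn0 mul1n.
by rewrite addnS addSn !ffactSS IHi mulnA.
Qed.

Lemma prod_shift_ffact (n i r : nat) : (i <= r)%N ->
  ((\prod_(i.+1 <= j < r.+1) (n + j)) * (n + i) ^_ i = (n + r) ^_ r)%N.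
Proof.
elim: r => [|r IHr]; first by rewrite leqn0 => /eqP->; rewrite big_geq ?mul1n.
rewrite leq_eqVlt => /predU1P[->|]; first by rewrite big_geq ?mul1n.
rewrite ltnS => leir; rewrite big_nat_recr //= addnS ffactSS -(IHr leir).
by rewrite mulnAC mulnC.
Qed.

Definition falling_poly (K : fieldType) (s : nat) : {poly K} :=
  \prod_(j < s) ('X - j%:R%:P).

Lemma falling_polyS (K : fieldType) (s : nat) :
  falling_poly K s.+1 = falling_poly K s * ('X - s%:R%:P).
Proof. by rewrite /falling_poly big_ord_recr. Qed.

Lemma falling_poly_monic (K : fieldType) (s : nat) : falling_poly K s \is monic.
Proof. by apply: monic_prod => j _; apply: monicXsubC. Qed.

Lemma size_falling_poly (K : fieldType) (s : nat) : size (falling_poly K s) = s.+1.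
Proof.
elim: s => [|s IHs]; first by rewrite /falling_poly big_ord0 size_poly1.
by rewrite falling_polyS size_Mmonic ?monicXsubC ?monic_neq0 ?falling_poly_monic //
  IHs size_XsubC addn2.
Qed.

Lemma horner_falling_poly (K : fieldType) (s n : nat) :
  (falling_poly K s).[n%:R] = (n ^_ s)%:R.
Proof.
elim: s => [|s IHs]; first by rewrite /falling_poly big_ord0 hornerE ffactn0.
rewrite falling_polyS hornerM IHs !hornerE ffactnSr natrM.
case: (ltnP n s) => [ltns|lesn]; first by rewrite ffact_small // !mul0r.
by rewrite natrB.
Qed.

(** The falling factorials are monic, one in each degree, so the leading term
    can be cancelled repeatedly. *)
Lemma falling_poly_expansion (K : fieldType) (N : nat) (P : {poly K}) :
  (size P <= N)%N -> exists e : nat -> K, P = \sum_(s < N) e s *: falling_poly K s.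
Proof.
elim: N P => [|N IHN] P.
  by rewrite leqn0 size_poly_eq0 => /eqP->; exists (fun=> 0); rewrite big_ord0.
move=> szP.
have /IHN[e Pe] : (size (P - P`_N *: falling_poly K N)%R <= N)%N.
  apply/leq_sizeP => j; rewrite leq_eqVlt => /predU1P[<-|ltNj].
    have /monicP := falling_poly_monic K N; rewrite lead_coefE.
    rewrite size_falling_poly /= => lc1.
    by rewrite coefB coefZ lc1 mulr1 subrr.
  rewrite coefB coefZ [P`_j]nth_default ?(leq_trans szP) //.
  by rewrite [_`_j]nth_default ?size_falling_poly // mulr0 subr0.
exists (fun s => if (s < N)%N then e s else P`_N).
rewrite big_ord_recr /= ltnn -[LHS](subrK (P`_N *: falling_poly K N)) Pe; congr (_ + _).
by apply: eq_bigr => i _; rewrite ltn_ord.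
Qed.

(** The cofactor of [(n + i) ^_ i] in [(n + r) ^_ r], as a polynomial in [n]. *)
Definition rising_poly (K : fieldType) (i r : nat) : {poly K} :=
  \prod_(i.+1 <= j < r.+1) ('X + j%:R%:P).

Lemma rising_poly_monic (K : fieldType) (i r : nat) : rising_poly K i r \is monic.
Proof.
by apply: monic_prod => j _; rewrite -[_%:P]opprK -polyCN monicXsubC.
Qed.

Lemma size_rising_poly (K : fieldType) (i r : nat) :
  size (rising_poly K i r) = (r - i).+1.
Proof.
have -> : rising_poly K i r =
    \prod_(x <- [seq - j%:R | j <- index_iota i.+1 r.+1]) ('X - x%:P).
  by rewrite big_map; apply: eq_bigr => j _; rewrite polyCN opprK.
by rewrite size_prod_XsubC size_map size_iota subSS.
Qed.

Lemma horner_rising_poly (K : fieldType) (i r n : nat) : (i <= r)%N ->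
  ((n + i) ^_ i)%:R * (rising_poly K i r).[n%:R] = ((n + r) ^_ r)%:R.
Proof.
move=> leir; rewrite -(prod_shift_ffact _ leir) natrM natr_prod mulrC.
congr (_ * _); rewrite horner_prod; apply: eq_bigr => j _.
by rewrite !hornerE natrD.
Qed.

(** * Differential operators acting on coefficients *)

Lemma fps_derivnE (K : fieldType) (t : nat) (f : fps K) (n : nat) :
  fps_derivn t f n = ((n + t) ^_ t)%:R * f (n + t)%N.
Proof.
elim: t n => [|t IHt] n; first by rewrite addn0 ffactn0 mul1r.
rewrite /fps_derivn iterS /fps_deriv -/(fps_derivn t f) IHt mulrA -natrM.
by rewrite addSnnS ffactnSr -addSnnS addnK mulnC.
Qed.

Lemma fps_mul_poly_sum (K : fieldType) (I : Type) (s : seq I) (P : pred I)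
    (c : I -> K) (Q : I -> {poly K}) (f : fps K) (n : nat) :
  fps_mul_poly (\sum_(i <- s | P i) c i *: Q i) f n =
  \sum_(i <- s | P i) c i * fps_mul_poly (Q i) f n.
Proof.
rewrite /fps_mul_poly.
under [RHS]eq_bigr do rewrite mulr_sumr.
rewrite exchange_big /=; apply: eq_bigr => j _.
rewrite coef_sum mulr_suml; apply: eq_bigr => i _.
by rewrite coefZ mulrA.
Qed.

(** Coefficients with [n < s] need no separate formula: the falling factorial
    vanishes there, as the left-hand side does. *)
Lemma fps_mulXn_derivn (K : fieldType) (s i : nat) (g : fps K) (n : nat) :
  fps_mul_poly 'X^s (fps_derivn (s + i) g) n =
  ((n + i) ^_ (s + i))%:R * g (n + i)%N.
Proof.
rewrite /fps_mul_poly; case: (leqP s n) => [lesn|ltns].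
  rewrite (bigD1 (Ordinal (lesn : (s < n.+1)%N))) //= big1 => [|j /eqP/val_eqP /=].
    by rewrite coefXn eqxx mul1r addr0 fps_derivnE addnA subnK.
  by rewrite coefXn => /negbTE->; rewrite mul0r.
rewrite ffact_small ?ltn_add2r // mul0r big1 // => j _.
by rewrite coefXn ltn_eqF ?mul0r // (leq_ltn_trans _ ltns) // -ltnS.
Qed.

(** The polynomial coefficient of [D ^ t] in the operator
    [\sum_i \sum_s e i s *: x ^ s D ^ (s + i)]. *)
Definition operator_coef (K : fieldType) (r : nat) (e : 'I_r.+1 -> nat -> K)
    (t : nat) : {poly K} :=
  \sum_(i < r.+1 | (i <= t)%N) e i (t - i)%N *: 'X^(t - i).

Lemma size_operator_coef (K : fieldType) (r : nat) (e : 'I_r.+1 -> nat -> K)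
    (t : nat) : (size (operator_coef e t) <= t.+1)%N.
Proof.
apply: (leq_trans (size_sum _ _ _)); apply/bigmax_leqP => i _.
by rewrite (leq_trans (size_scale_leq _ _)) // size_polyXn ltnS leq_subr.
Qed.

(** Distinct shifts [i] contribute distinct powers of [x] to the coefficient of a
    given derivative; hence a nonzero [e] gives a nonzero operator. *)
Lemma coef_operator_coef (K : fieldType) (r : nat) (e : 'I_r.+1 -> nat -> K)
    (i : 'I_r.+1) (s : nat) : (operator_coef e (s + i))`_s = e i s.
Proof.
rewrite /operator_coef coef_sum (bigD1 i) ?leq_addl //= big1 ?addr0 => [|j /andP[lej]].
  by rewrite coefZ coefXn addnK eqxx mulr1.
move=> neji; rewrite coefZ coefXn; case: eqP => [sE|]; last by rewrite mulr0.
have /addnI/val_inj ij : (s + i = s + j)%N by rewrite {2}sE subnK.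
by rewrite ij eqxx in neji.
Qed.

(** Cutting all shifts at the same order [T] leaves [T - i] terms for the shift
    [i], which is the number of falling factorials that the degree bound on the
    cofactor asks for. *)
Lemma operator_coef_apply (K : fieldType) (r T : nat) (e : 'I_r.+1 -> nat -> K)
    (g : fps K) (n : nat) :
  \sum_(t < T) fps_mul_poly (operator_coef e t) (fps_derivn t g) n =
  \sum_(i < r.+1) ((n + i) ^_ i)%:R
     * (\sum_(s < T - i) e i s *: falling_poly K s).[n%:R] * g (n + i)%N.
Proof.
under eq_bigr do rewrite fps_mul_poly_sum.
rewrite (exchange_big_dep xpredT) //=; apply: eq_bigr => i _.
rewrite -(big_geq_mkord _ _ xpredT (fun t =>
  e i (t - i)%N * fps_mul_poly 'X^(t - i) (fps_derivn t g) n)).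
rewrite -[X in index_iota X]add0n big_addn big_mkord horner_sum.
rewrite mulr_sumr mulr_suml; apply: eq_bigr => s _.
rewrite addnK fps_mulXn_derivn hornerZ horner_falling_poly (addnC s) ffact_addl.
by rewrite natrM -!mulrA mulrCA.
Qed.

(** * The contribution of one nonzero root *)

(** The clause on [p i != 0] is what makes the final equation nontrivial. *)
Lemma dilated_operator (K : fieldType) (r k : nat) (alpha : K)
    (p : 'I_r.+1 -> {poly K}) :
  alpha != 0 -> (forall i, (size (p i) <= k.+1)%N) ->
  exists q : nat -> {poly K},
    [/\ forall t, (size (q t) <= t.+1)%N,
        forall i, p i != 0 -> exists2 t, (t <= r + k)%N & q t != 0 &
        forall (a : nat -> K) (n : nat),
          \sum_(t < (r + k).+1)
            fps_mul_poly (q t) (fps_derivn t (fps_dilate alpha a)) n =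
          ((n + r) ^_ r)%:R *
            \sum_(i < r.+1) (p i).[n%:R] * alpha ^+ n * a (n + i)%N].
Proof.
move=> alpha0 szp.
pose P (i : 'I_r.+1) := alpha ^- i *: (rising_poly K i r * p i).
have szP i : (size (P i) <= (r + k).+1 - i)%N.
  rewrite /P (leq_trans (size_scale_leq _ _)) //.
  have [->|p0] := eqVneq (p i) 0; first by rewrite mulr0 size_poly0.
  rewrite size_monicM ?rising_poly_monic // size_rising_poly addSn /=.
  rewrite (leq_trans (leq_add (leqnn _) (szp i))) // addnS subSn ?ltnS.
    by rewrite addnBAC // -ltnS ltn_ord.
  by rewrite (leq_trans _ (leq_addr _ _)) // -ltnS ltn_ord.
have [e eP] := choice (fun i => falling_poly_expansion (szP i)).
exists (operator_coef e); split=> [t|i pi0|a n]; first exact: size_operator_coef.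
- have Pi0 : P i != 0.
    by rewrite scaler_eq0 invr_eq0 expf_eq0 (negbTE alpha0) andbF /=
      mulf_neq0 // monic_neq0 ?rising_poly_monic.
  have [s es0] : exists s : 'I_((r + k).+1 - i), e i s != 0.
    apply/existsP; apply: contraR Pi0 => /existsPn e0.
    by rewrite eP big1 // => s _; move/negPn/eqP: (e0 s) ->; rewrite scale0r.
  exists (s + i)%N; first by have := ltn_ord s; rewrite ltn_subRL addnC ltnS.
  by apply: contraNneq es0 => q0; rewrite -(coef_operator_coef e) q0 coef0.
rewrite operator_coef_apply mulr_sumr; apply: eq_bigr => i _.
have leir : (i <= r)%N by rewrite -ltnS.
rewrite -eP /P hornerZ hornerM /fps_dilate exprD -(horner_rising_poly K n leir).
rewrite -!mulrA; congr (_ * _).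
do 3 (rewrite mulrCA; congr (_ * _)).
by rewrite mulKf ?expf_neq0.
Qed.

(** * Characteristic roots and closed forms *)

Lemma finite_roots_of (K : fieldType) (chi : {poly K}) :
  chi != 0 -> finite_set (roots_of chi).
Proof.
move=> chi0; apply: contrapT => /(@infinite_set_fset _ _ (size chi))[B Bsub].
rewrite leqNgt => /negP; apply; apply: max_poly_roots => //.
  by apply/allP => x xB; apply: Bsub.
exact: finmap.fset_uniq.
Qed.

Lemma finite_all_char_roots (K : fieldType) (r : nat)
    (chi : 'I_r.+1 -> {poly K}) :
  (forall i, chi i != 0) -> finite_set (all_char_roots chi).
Proof.
move=> chi0.
have -> : all_char_roots chi = \bigcup_(i in setT) roots_of (chi i).
  apply/seteqP; split=> x []; first by move=> i ri; exists i.
  by move=> i _ ri; exists i.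
by apply: bigcup_finite => // i _; apply: finite_roots_of.
Qed.

(** Writing all closed forms over the union of the root sets, padding with zero
    polynomials, lets the sums over roots and over shifts be exchanged. *)
Lemma common_closed_form (K : fieldType) (r k : nat)
    (c : 'I_r.+1 -> nat -> K) (chi : 'I_r.+1 -> {poly K}) :
  (forall i, Deg_le (c i) (chi i) k) ->
  exists2 p : K -> 'I_r.+1 -> {poly K},
    forall alpha i, (size (p alpha i) <= k.+1)%N &
    forall i n, c i n =
      \sum_(alpha \in all_char_roots chi) (p alpha i).[n%:R] * alpha ^+ n.
Proof.
move=> degc.
have degc' i : exists p, closed_form (c i) (chi i) p /\
    forall alpha, roots_of (chi i) alpha -> (size (p alpha) <= k.+1)%N.
  by have [p] := degc i; exists p.
have [p pP] := choice degc'.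
exists (fun alpha i => if root (chi i) alpha then p i alpha else 0).
  move=> alpha i; case: ifP => [rt|_]; last by rewrite size_poly0.
  exact: (pP i).2.
move=> i n; rewrite (pP i).1.
rewrite -(@fsbig_widen _ _ _ _ (roots_of (chi i)) (all_char_roots chi)).
- by apply: eq_fsbigr => alpha /set_mem /= ->.
- by move=> alpha rt; exists i.
- by move=> alpha [_ /negP/negbTE nrt] /=; rewrite nrt horner0 mul0r.
Qed.

(** * The order of the equation *)

Lemma exists_last (P : nat -> Prop) (N t0 : nat) : (t0 <= N)%N -> P t0 ->
  exists m, [/\ (m <= N)%N, P m & forall t, (m < t <= N)%N -> ~ P t].
Proof.
move=> let0 Pt0.
have exP : exists t, (t <= N)%N && `[< P t >].
  by exists t0; rewrite let0; apply/asboolP.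
have ub t : (t <= N)%N && `[< P t >] -> (t <= N)%N by case/andP.
case: (ex_maxnP exP ub) => m /andP[lem /asboolP Pm] maxm.
exists m; split=> // t /andP[ltmt letN] Pt.
by have := maxm t; rewrite letN asboolT // leqNgt ltmt => /(_ isT).
Qed.

(** The order of the equation has to be attained by some root, so the
    derivatives whose coefficients vanish for all roots are cut off at the
    top. *)
Lemma drop_zero_top (K : fieldType) (D : set K) (N t0 : nat) (alpha0 : K)
    (q : K -> nat -> {poly K}) (g : K -> nat -> fps K) :
  (t0 <= N)%N -> D alpha0 -> q alpha0 t0 != 0 ->
  (forall n, \sum_(alpha \in D)
     \sum_(t < N.+1) fps_mul_poly (q alpha t) (g alpha t) n = 0) ->
  exists r', [/\ (r' <= N)%N, exists2 alpha, D alpha & q alpha r' != 0 &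
    forall n, \sum_(alpha \in D)
      \sum_(t < r'.+1) fps_mul_poly (q alpha t) (g alpha t) n = 0].
Proof.
move=> let0 Dalpha0 q0 sum0.
have [|m [lem Pm maxm]] :=
  @exists_last (fun t => exists2 alpha, D alpha & q alpha t != 0) N t0 let0.
  by exists alpha0.
exists m; split=> // n; rewrite -[RHS](sum0 n).
apply: eq_fsbigr => alpha /set_mem Dalpha.
rewrite (big_ord_widen N.+1
  (fun t => fps_mul_poly (q alpha t) (g alpha t) n)) // big_mkcond /=.
apply: eq_bigr => t _; case: ltnP => // ltmt.
have -> : q alpha t = 0.
  apply/eqP; case: eqVneq => // qt0; case: (maxm t).
    by rewrite ltmt -ltnS ltn_ord.
  by exists alpha.
by rewrite /fps_mul_poly big1 // => j _; rewrite coef0 mul0r.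
Qed.

(** * The two cases *)

Lemma C2_recurrence_order0 (K : fieldType) (k : nat) (c : 'I_1 -> nat -> K)
    (chi : 'I_1 -> {poly K}) (a : nat -> K) (n : nat) :
  C2_recurrence k c chi a -> a n = 0.
Proof.
move=> [_ _ /(_ n) + /(_ n) /eqP].
by rewrite (ord1 ord_max) big_ord1 addn0 mulf_eq0 => /negbTE-> /eqP.
Qed.

Lemma fps_derivn_dilate0 (K : fieldType) (m : nat) (a : nat -> K) (n : nat) :
  (0 < m)%N -> fps_derivn m (fps_dilate 0 a) n = 0.
Proof.
move=> m_gt0; rewrite fps_derivnE /fps_dilate expr0n addn_eq0.
by rewrite (gtn_eqF m_gt0) andbF mul0r mulr0.
Qed.

Lemma fps_mul_poly0 (K : fieldType) (q : {poly K}) (f : fps K) (n : nat) :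
  (forall m, f m = 0) -> fps_mul_poly q f n = 0.
Proof. by move=> f0; rewrite /fps_mul_poly big1 // => i _; rewrite f0 mulr0. Qed.

(** For [r + k > 0] because [f(0 x)] is constant; for [r + k = 0] because
    [f = 0]. *)
Lemma annihilator_zero_root (K : fieldType) (r k : nat)
    (c : 'I_r.+1 -> nat -> K) (chi : 'I_r.+1 -> {poly K}) (a : nat -> K)
    (n : nat) : C2_recurrence k c chi a ->
  fps_derivn (r + k) (fps_dilate 0 a) n = 0.
Proof.
have [/eqP|/fps_derivn_dilate0-> //] := posnP (r + k).
rewrite addn_eq0 => /andP[/eqP r0 /eqP ->].
subst r => rec.
by rewrite fps_derivnE /fps_dilate (C2_recurrence_order0 _ rec) !mulr0.
Qed.

(** If 0 is not a root, summing [dilated_operator] over the roots reproduces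
    [(n + r) ^_ r] times the recurrence at [n]. *)
Lemma annihilator_nonzero_roots (K : fieldType) (r k : nat)
    (c : 'I_r.+1 -> nat -> K) (chi : 'I_r.+1 -> {poly K}) (a : nat -> K) :
  C2_recurrence k c chi a -> ~ all_char_roots chi 0 ->
  exists q : K -> nat -> {poly K},
    [/\ forall alpha t, (size (q alpha t) <= t.+1)%N,
        exists2 alpha, all_char_roots chi alpha &
          exists2 t, (t <= r + k)%N & q alpha t != 0 &
        forall n, \sum_(alpha \in all_char_roots chi)
          \sum_(t < (r + k).+1)
            fps_mul_poly (q alpha t)
              (fps_derivn t (fps_dilate alpha a)) n = 0].
Proof.
move=> [charc degc cr0 rec] root0.
have finD : finite_set (all_char_roots chi).
  by apply: finite_all_char_roots => i; apply/monic_neq0/(charc i).1.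
have [p szp cE] := common_closed_form degc.
have qex alpha : exists q : nat -> {poly K}, alpha != 0 ->
    [/\ forall t, (size (q t) <= t.+1)%N,
        forall i, p alpha i != 0 -> exists2 t, (t <= r + k)%N & q t != 0 &
        forall n, \sum_(t < (r + k).+1)
            fps_mul_poly (q t) (fps_derivn t (fps_dilate alpha a)) n =
          ((n + r) ^_ r)%:R *
            \sum_(i < r.+1) (p alpha i).[n%:R] * alpha ^+ n * a (n + i)%N].
  have [->|alpha0] := eqVneq alpha 0; first by exists (fun=> 0); rewrite eqxx.
  have [q [q1 q2 q3]] := dilated_operator alpha0 (szp alpha).
  by exists q => _; split.
have [q qP] := choice qex.
have rootN0 alpha : all_char_roots chi alpha -> alpha != 0.
  by move=> Da; apply/eqP => a0; apply: root0; rewrite -a0.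
exists (fun alpha t => if alpha == 0 then 0 else q alpha t); split.
- move=> alpha t; case: eqP => [_|/eqP/qP[]//]; by rewrite size_poly0.
(* If all [p alpha ord_max] vanished, then so would [c ord_max]. *)
- have [alpha Dalpha palpha] : exists2 alpha, all_char_roots chi alpha &
      p alpha ord_max != 0.
    apply: contrapT => noalpha; have /eqP := cr0 0%N; apply.
    rewrite cE fsbig1 // => alpha Dalpha.
    case: (eqVneq (p alpha ord_max) 0) => [->|pn0]; first by rewrite horner0 mul0r.
    by case: noalpha; exists alpha.
  exists alpha => //; rewrite (negbTE (rootN0 _ Dalpha)).
  by have [_ /(_ _ palpha)] := qP _ (rootN0 _ Dalpha).
move=> n; transitivity (\sum_(alpha \in all_char_roots chi)
    ((n + r) ^_ r)%:R *
      \sum_(i < r.+1) (p alpha i).[n%:R] * alpha ^+ n * a (n + i)%N).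
  apply: eq_fsbigr => alpha /set_mem Dalpha.
  rewrite (negbTE (rootN0 _ Dalpha)).
  by have [_ _ ->] := qP _ (rootN0 _ Dalpha).
rewrite fsbig_finite //= -mulr_sumr exchange_big /=.
rewrite -[RHS](mulr0 ((n + r) ^_ r)%:R) -[in RHS](rec n).
congr (_ * _); apply: eq_bigr => i _.
by rewrite cE fsbig_finite //= mulr_suml.
Qed.

Theorem corollary18 (R : realType) (r k : nat) (a : nat -> R[i])
    (c : 'I_r.+1 -> nat -> R[i]) (chi : 'I_r.+1 -> {poly R[i]})
    (ha : C2_recurrence k c chi a) :
  exists (r' : nat) (q : R[i] -> nat -> {poly R[i]}),
    [/\ (r' <= r + k)%N,
        forall (alpha : R[i]) (t : nat),
          all_char_roots chi alpha ->
          (t <= r')%N -> (size (q alpha t) <= (r + k).+1)%N,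
        exists2 alpha : R[i],
          all_char_roots chi alpha &
          q alpha r' != 0 &
        forall n : nat,
          \sum_(alpha \in all_char_roots chi)
            \sum_(t < r'.+1)
              fps_mul_poly (q alpha t)
                (fps_derivn t (fps_dilate alpha a)) n = 0].
Proof.
have [root0|root0] := pselect (all_char_roots chi 0).
  exists (r + k)%N, (fun alpha t => ((alpha == 0) && (t == r + k)%N)%:R).
  split=> //.
  - move=> alpha t _ _; case: (_ && _); last by rewrite size_poly0.
    by rewrite size_poly1.
  - by exists 0; rewrite ?eqxx ?oner_neq0.
  move=> n; apply: fsbig1 => alpha _; apply: big1 => t _.
  have [->|_] := eqVneq alpha 0; last first.
    by rewrite /fps_mul_poly big1 // => i _; rewrite coef0 mul0r.
  have [->|_] := eqVneq (t : nat) (r + k)%N; last first.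
    by rewrite /fps_mul_poly big1 // => i _; rewrite coef0 mul0r.
  by apply: fps_mul_poly0 => m; apply: annihilator_zero_root ha.
have [q [szq [alpha Dalpha [t le_t qt0]] sum0]] :=
  annihilator_nonzero_roots ha root0.
have [r' [ler' top sum0']] := @drop_zero_top _ _ _ _ _ _
  (fun beta s => fps_derivn s (fps_dilate beta a)) le_t Dalpha qt0 sum0.
exists r', q; split=> // beta s _ les.
by rewrite (leq_trans (szq _ _)) // ltnS (leq_trans les).
Qed.
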